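(* Let $n\geq 2$ and let $f\in\mathbb{C}[x_1,\dots,x_n]$ be a homogeneous polynomial of degree $d\geq 1$ defining a hypersurface $Z\subset\mathbb{P}^{n-1}$ whose associated reduced hypersurface $Z_{\rm red}$ has only weighted homogeneous isolated singularities. Assume $Z$ is reduced. If $f$ is annihilated by a nonzero vector field $\xi$ of degree $0$, then $f$ is also annihilated by the semisimple part $\xi'$ of $\xi$.
   Context: A vector field of degree $0$ on $\mathbb{C}^n$ is one of the form $\xi=\sum_{i,j=1}^n c_{i,j}x_i\partial_{x_j}$ with $c_{i,j}\in\mathbb{C}$; it annihilates $f$ if $\xi(f)=0$. Its semisimple part $\xi'$ is defined using Jordan normal form: after a linear change of coordinates making the matrix $(c_{i,j})$ a Jordan normal form, $\xi'=\sum_i c_{i,i}x_i\partial_{x_i}$ (equivalently, $\xi'$ corresponds to the semisimple part of the matrix in its additive Jordan decomposition). An isolated hypersurface singularity is weighted homogeneous if, in suitable local analytic coordinates, the germ is defined by a weighted homogeneous polynomial (with strictly positive rational weights) having an isolated singularity at the origin. *)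

(* Defs.v *)
From HB Require Import structures.
From mathcomp Require Import all_boot all_order all_algebra.
From mathcomp Require Import complex mpoly.
(* The Jacobian and directional-derivative notations of [derive] clash with
   those of [mpoly]; only [differentiable] is needed here. *)
From mathcomp Require Import -(notations) derive.
From mathcomp Require Import boolp classical_sets functions reals.
From mathcomp Require Import topology normedtype.

Set Implicit Arguments.
Unset Strict Implicit.
Unset Printing Implicit Defensive.

Import Order.TTheory GRing.Theory Num.Theory.
Import numFieldNormedType.Exports.

Local Open Scope classical_set_scope.
Local Open Scope ring_scope.

Section LinearVectorFields.
Variables (K : fieldType) (n : nat).
Implicit Types (c s P J : 'M[K]_n) (p : {mpoly K[n]}).

(* The degree-0 vector field  sum_(i, j) c_ij x_i d/dx_j. *)
Definition linear_vf c p : {mpoly K[n]} :=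
  \sum_(i < n) \sum_(j < n) c i j *: ('X_i * p^`M(j)).

Definition jordan_normal_form J : Prop :=
  forall i j : 'I_n,
    (j != i -> j != i.+1 :> nat -> J i j = 0) /\
    (j = i.+1 :> nat -> J i j = 0 \/ (J i j = 1 /\ J i i = J j j)).

(* As [linear_vf c] sends x_j to the j-th entry of the row x c, in the
   coordinates y = x P its matrix is P^-1 c P; the field
   sum_i J_ii y_i d/dy_i has matrix P diag(J) P^-1 in the coordinates x. *)
Definition semisimple_part_of c s : Prop :=
  exists P J, [/\ P \in unitmx, jordan_normal_form J,
    invmx P *m c *m P = J &
    s = P *m diag_mx (\row_i J i i) *m invmx P].

End LinearVectorFields.

Section HypersurfaceEquations.
Variables (K : fieldType) (n : nat).
Implicit Types f g h : {mpoly K[n]}.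

Definition mpoly_dvd g h : Prop := exists q, h = q * g.

(* (f) is a radical ideal.  For n >= 2 the ideal of a nonzero homogeneous f
   is saturated, so this says that the subscheme f = 0 of P^(n-1) is
   reduced. *)
Definition reduced_eqn f : Prop :=
  forall h k, mpoly_dvd f (h ^+ k) -> mpoly_dvd f h.

(* (g) is the radical of (f): g is an equation of the associated reduced
   hypersurface. *)
Definition eqn_of_red f g : Prop :=
  forall h, mpoly_dvd g h <-> exists k, mpoly_dvd f (h ^+ k).

(* Equation, in the chart x_i = 1 of P^(n-1), of the projective hypersurface
   defined by a homogeneous polynomial f. *)
Definition dehomogenize (i : 'I_n) f : {mpoly K[n.-1]} :=
  f \mPo [tuple (if unlift i j is Some k then 'X_k else 1) | j < n].

Definition singular_point g (p : 'rV[K]_n) : Prop :=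
  g.@[p 0] = 0 /\ forall i, g^`M(i).@[p 0] = 0.

Definition weighted_homogeneous h : Prop :=
  exists w : 'I_n -> rat, (forall i, 0 < w i) /\
  exists D : rat, forall m, m \in msupp h -> \sum_i w i *+ m i = D.

End HypersurfaceEquations.

(* The library declares this instance only for abstract number fields. *)
HB.instance Definition _ (R : realType) := PseudoPointedMetric.copy R[i] (R[i])^o.

Section Singularities.
Variables (R : realType) (n : nat).
Local Notation C := R[i].
Implicit Types (g h : {mpoly C[n]}) (p : 'rV[C]_n).

Definition holomorphic_near (U V : normedModType C) (F : U -> V) (x : U) :
    Prop :=
  \forall y \near x, differentiable F y.

Definition isolated_singular_point g p : Prop :=
  singular_point g p /\ \forall q \near p, singular_point g q -> q = p.

(* phi is (a representative of) a germ of biholomorphic map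
   (C^n, 0) -> (C^n, p). *)
Definition local_coordinates (phi : 'rV[C]_n -> 'rV[C]_n) p : Prop :=
  [/\ phi 0 = p, holomorphic_near phi 0 &
    exists psi : 'rV[C]_n -> 'rV[C]_n,
      [/\ psi p = 0, holomorphic_near psi p,
          \forall y \near (0 : 'rV[C]_n), psi (phi y) = y &
          \forall q \near p, phi (psi q) = q]].

(* u is a unit of the local ring at 0, so that g o phi and h generate the same
   ideal of germs at 0. *)
Definition weighted_homogeneous_germ g p : Prop :=
  exists (phi : 'rV[C]_n -> 'rV[C]_n) (u : 'rV[C]_n -> C^o) h,
    [/\ local_coordinates phi p,
        holomorphic_near u 0 /\ u 0 != 0,
        weighted_homogeneous h,
        isolated_singular_point h 0 &
        \forall y \near (0 : 'rV[C]_n), g.@[(phi y) 0] = u y * h.@[y 0]].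

End Singularities.

(* The charts x_i = 1 cover P^(n-1). *)
Definition only_wh_isolated_singularities (R : realType) (n : nat)
    (f : {mpoly R[i][n]}) : Prop :=
  forall (i : 'I_n) (p : 'rV[R[i]]_n.-1),
    singular_point (dehomogenize i f) p ->
    isolated_singular_point (dehomogenize i f) p /\
    weighted_homogeneous_germ (dehomogenize i f) p.

(* Main.v *)
(* In Jordan coordinates every monomial X^m is an eigenvector of the semisimple
   part, with eigenvalue sum_i J_ii m_i, while the nilpotent part preserves this
   eigenvalue and strictly lowers the weight sum_i (i + 1) m_i.  If xi kills f,
   then among the monomials of f with nonzero eigenvalue there is none of
   maximal weight, hence none at all: f is killed by the semisimple part. *)
Require Import Defs.
From HB Require Import structures.
From mathcomp Require Import all_boot all_order all_algebra.
From mathcomp Require Import complex mpoly reals.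

Set Implicit Arguments.
Unset Strict Implicit.
Unset Printing Implicit Defensive.

Import Order.TTheory GRing.Theory Num.Theory.

Local Open Scope ring_scope.

Section LinearVectorFieldTheory.
Variables (K : fieldType) (n : nat).
Implicit Types (b c s A B J : 'M[K]_n) (p q g : {mpoly K[n]}) (m : 'X_{1..n}).

Lemma linear_vf_is_linear c : linear (linear_vf c).
Proof.
move=> a p q; rewrite /linear_vf scaler_sumr -big_split; apply: eq_bigr => i _.
rewrite scaler_sumr -big_split; apply: eq_bigr => j _.
by rewrite mderivD mderivZ mulrDr -scalerAr scalerDr !scalerA mulrC.
Qed.

HB.instance Definition _ c :=
  GRing.isLinear.Build K {mpoly K[n]} {mpoly K[n]} _ (linear_vf c)
    (linear_vf_is_linear c).

Lemma linear_vfM c p q :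
  linear_vf c (p * q) = linear_vf c p * q + p * linear_vf c q.
Proof.
rewrite /linear_vf mulr_suml mulr_sumr -big_split; apply: eq_bigr => i _.
rewrite mulr_suml mulr_sumr -big_split; apply: eq_bigr => j _.
by rewrite mderivM mulrDr scalerDr -scalerAl -scalerAr !mulrA ['X_i * p]mulrC.
Qed.

Lemma linear_vf1 c : linear_vf c 1 = 0.
Proof.
have /eqP := linear_vfM c 1 1.
by rewrite !mulr1 mul1r -subr_eq subrr => /eqP.
Qed.

Lemma linear_vfXU c (j : 'I_n) : linear_vf c 'X_j = \sum_i c i j *: 'X_i.
Proof.
apply: eq_bigr => i _; rewrite (bigD1 j) //= big1 ?addr0 => [|k kj].
  by rewrite mderivX mnm1E eqxx scale1r -{1}[U_(j)%MM]add0m addmK mpolyX0 mulr1.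
by rewrite mderivX mnm1E eq_sym (negPf kj) scale0r mulr0 scaler0.
Qed.

(** Images are read off the columns of [A], as in [linear_vf], so that both operations act on the
    coefficient column of a linear form by left multiplication. *)
Definition linear_subst A p : {mpoly K[n]} :=
  p \mPo [tuple \sum_i A i j *: 'X_i | j < n].

HB.instance Definition _ A :=
  GRing.RMorphism.copy (linear_subst A)
    (comp_mpoly [tuple \sum_i A i j *: 'X_i | j < n]).
HB.instance Definition _ A :=
  GRing.Linear.copy (linear_subst A)
    (comp_mpoly [tuple \sum_i A i j *: 'X_i | j < n]).

Lemma linear_substXU A (j : 'I_n) : linear_subst A 'X_j = \sum_i A i j *: 'X_i.
Proof. by rewrite /linear_subst comp_mpolyXU -tnth_nth tnth_mktuple. Qed.

Lemma linear_subst_form A B (j : 'I_n) :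
  linear_subst A (\sum_i B i j *: 'X_i) = \sum_i (A *m B) i j *: 'X_i.
Proof.
rewrite linear_sum /=.
under eq_bigr do rewrite linearZ /= linear_substXU scaler_sumr.
rewrite exchange_big; apply: eq_bigr => k _ /=; rewrite mxE scaler_suml.
by apply: eq_bigr => i _; rewrite scalerA mulrC.
Qed.

Lemma linear_vf_form c A (j : 'I_n) :
  linear_vf c (\sum_i A i j *: 'X_i) = \sum_i (c *m A) i j *: 'X_i.
Proof.
rewrite linear_sum /=.
under eq_bigr do rewrite linearZ /= linear_vfXU scaler_sumr.
rewrite exchange_big; apply: eq_bigr => k _ /=; rewrite mxE scaler_suml.
by apply: eq_bigr => i _; rewrite scalerA mulrC.
Qed.

(** Reduces identities between derivations or algebra morphisms to the variables. *)
Lemma mpoly_alg_ind (S : {mpoly K[n]} -> Prop) :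
    S 1 -> (forall i, S 'X_i) -> (forall p q, S p -> S q -> S (p * q)) ->
    (forall a p q, S p -> S q -> S (a *: p + q)) ->
  forall p, S p.
Proof.
move=> S1 SX SM SD p; elim/mpolyind: p => [|a m p _ _ Sp].
  (* The zero polynomial arises as [-1 *: 1 + 1]. *)
  by have := SD (-1) _ _ S1 S1; rewrite scaleN1r addNr.
apply: (SD) => //; rewrite mpolyXE_id; apply: big_ind => // i _.
by elim: (m i) => [|k IHk]; rewrite ?expr0 // exprS; apply: SM.
Qed.

(** Both sides are derivations along the morphism [linear_subst A], so they agree once they agree on
    the variables, where the claim is the matrix identity. *)
Lemma linear_vf_subst c b A p : c *m A = A *m b ->
  linear_vf c (linear_subst A p) = linear_subst A (linear_vf b p).
Proof.
move=> cAb; elim/mpoly_alg_ind: p => [|j|p q IHp IHq|a p q IHp IHq].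
- by rewrite rmorph1 !linear_vf1 linear0.
- by rewrite linear_substXU linear_vfXU linear_vf_form linear_subst_form cAb.
- by rewrite rmorphM /= !linear_vfM IHp IHq rmorphD /= !rmorphM.
- by rewrite !linearP /= IHp IHq.
Qed.

Lemma linear_substK A B : A *m B = 1%:M ->
  cancel (linear_subst B) (linear_subst A).
Proof.
move=> AB1; elim/mpoly_alg_ind => [|j|p q IHp IHq|a p q IHp IHq].
- by rewrite !rmorph1.
- rewrite linear_substXU linear_subst_form AB1 (bigD1 j) //= big1.
    by rewrite mxE eqxx scale1r addr0.
  by move=> k kj; rewrite mxE (negPf kj) scale0r.
- by rewrite !rmorphM /= IHp IHq.
- by rewrite !linearP /= IHp IHq.
Qed.

(** The guard matters because subtraction of multi-indices truncates at zero. *)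
Lemma mcoeffXUM i p m :
  ('X_i * p)@_m = if (U_(i) <= m)%MM then p@_(m - U_(i)) else 0.
Proof.
rewrite mulrC; case: ifPn => [le_im|nle_im].
  by rewrite -{1}(submK le_im) addmC mcoeffMX.
apply: memN_msupp_eq0; rewrite (perm_mem (msuppMX p U_(i))).
by apply: contra nle_im => /mapP[m' _ ->]; apply: lem_addr.
Qed.

Definition eigenvalue_at J m := \sum_i J i i *+ m i.

Lemma eigenvalue_atD J m1 m2 :
  eigenvalue_at J (m1 + m2)%MM = eigenvalue_at J m1 + eigenvalue_at J m2.
Proof.
by rewrite -big_split; apply: eq_bigr => i _; rewrite mnmDE mulrnDr.
Qed.

Lemma eigenvalue_atU J i : eigenvalue_at J U_(i)%MM = J i i.
Proof.
rewrite /eigenvalue_at (bigD1 i) //= mnm1E eqxx mulr1n big1 ?addr0 // => j ji.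
by rewrite mnm1E eq_sym (negPf ji) mulr0n.
Qed.

Lemma mcoeff_linear_vf c p m :
  (linear_vf c p)@_m = \sum_i \sum_j c i j * ('X_i * p^`M(j))@_m.
Proof.
rewrite /linear_vf linear_sum; apply: eq_bigr => i _ /=.
by rewrite linear_sum; apply: eq_bigr => j _ /=; rewrite mcoeffZ.
Qed.

(** The operator [x_i d/dx_i] multiplies [X^m] by [m i]. *)
Lemma mcoeff_diag_vf J p m :
  (linear_vf (diag_mx (\row_i J i i)) p)@_m = eigenvalue_at J m * p@_m.
Proof.
rewrite mcoeff_linear_vf mulr_suml; apply: eq_bigr => i _.
rewrite (bigD1 i) //= big1 => [|j ji]; last first.
  by rewrite !mxE eq_sym (negPf ji) mulr0n mul0r.
rewrite addr0 !mxE eqxx mulr1n mulrnAl -mulrnAr; congr (_ * _).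
rewrite mcoeffXUM mcoeff_deriv; case: ifPn => [le_im|].
  rewrite submK // mnmBE mnm1E eqxx subn1 prednK //.
  by move: le_im; rewrite lep1mP lt0n.
by rewrite lep1mP negbK => /eqP ->.
Qed.

(* The nilpotent part of J maps X^m' to monomials with the same eigenvalue and
   weight one less, so at m it only sees coefficients of weight one more. *)
Lemma mcoeff_jordan_vf J p m : jordan_normal_form J ->
    (forall m', mnmwgt m' = (mnmwgt m).+1 ->
       eigenvalue_at J m' = eigenvalue_at J m -> p@_m' = 0) ->
  (linear_vf J p)@_m = eigenvalue_at J m * p@_m.
Proof.
(* Comparing with the diagonal field term by term leaves only the superdiagonal entries equal to
   1. *)
move=> JNF p_eq0; rewrite -mcoeff_diag_vf !mcoeff_linear_vf.
apply: eq_bigr => i _; apply: eq_bigr => j _; rewrite !mxE.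
case: eqVneq => [<-|ij]; first by rewrite mulr1n.
rewrite mulr0n mul0r; have [J0 J1] := JNF i j.
have [ji|/J0-> //] := eqVneq (j : nat) i.+1; rewrite ?mul0r // 1?eq_sym //.
have [->|[_ Jij]] := J1 ji; first by rewrite mul0r.
rewrite mcoeffXUM mcoeff_deriv; case: ifPn => [le_im|_]; last by rewrite mulr0.
(* The coefficient involved sits at [m - U_(i) + U_(j)]: since [j = i + 1] its weight is one more
   than that of [m], and [J i i = J j j] keeps the eigenvalue. *)
rewrite p_eq0 ?mul0rn ?mulr0 // -[in RHS](submK le_im).
  by rewrite !mnmwgtD !mnmwgt1 ji -addnS.
by rewrite !eigenvalue_atD !eigenvalue_atU Jij.
Qed.

Lemma jordan_vf_eq0 J p : jordan_normal_form J -> linear_vf J p = 0 ->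
  linear_vf (diag_mx (\row_i J i i)) p = 0.
Proof.
move=> JNF Jp0; apply/mpolyP => m; rewrite mcoeff_diag_vf mcoeff0.
have [->|lam_neq0] := eqVneq (eigenvalue_at J m) 0; first by rewrite mul0r.
suff -> : p@_m = 0 by rewrite mulr0.
(* [mweight p] strictly exceeds every weight occurring in [p], so induction on the gap [k] is a
   downward induction on the weight of [m]. *)
have [k] : exists k, (mweight p <= mnmwgt m + k)%N.
  by exists (mweight p); rewrite leq_addl.
elim: k m lam_neq0 => [|k IHk] m lam_neq0 le_pm.
  by move: le_pm; rewrite addn0 => /mmeasure_mnm_ge/memN_msupp_eq0.
have := congr1 (mcoeff m) Jp0; rewrite mcoeff0 mcoeff_jordan_vf //.
  by move/eqP; rewrite mulf_eq0 (negPf lam_neq0) => /eqP.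
by move=> m' wm' lam_m'; apply: IHk; rewrite ?lam_m' // wm' addSnnS.
Qed.

Lemma semisimple_part_vf_eq0 c s p : semisimple_part_of c s ->
  linear_vf c p = 0 -> linear_vf s p = 0.
Proof.
move=> [P [J [Punit JNF cPJ ->]]] cp0.
(* [linear_subst (invmx P) p] is [p] written in the Jordan coordinates; there [J] kills it because
   [c] kills [p]. *)
rewrite -(linear_substK (mulmxV Punit) p).
rewrite (@linear_vf_subst _ (diag_mx (\row_i J i i))); last first.
  by rewrite -!mulmxA mulVmx // mulmx1.
rewrite jordan_vf_eq0 ?linear0 //.
rewrite (@linear_vf_subst _ c) ?cp0 ?linear0 //.
by rewrite -cPJ -!mulmxA mulmxV // mulmx1.
Qed.

End LinearVectorFieldTheory.

Theorem lemma1 (R : realType) (n d : nat) (f fred : {mpoly R[i][n]})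
    (c c' : 'M[R[i]]_n)
    (n_ge2 : (2 <= n)%N)
    (d_ge1 : (1 <= d)%N)
    (f_neq0 : f != 0)
    (f_homog : f \is d.-homog)
    (Z_red : eqn_of_red f fred)
    (Z_red_sing : only_wh_isolated_singularities fred)
    (Z_reduced : reduced_eqn f)
    (xi_neq0 : c != 0)
    (xi_f : linear_vf c f = 0)
    (xi'_ss : semisimple_part_of c c') :
  linear_vf c' f = 0.
Proof. exact: semisimple_part_vf_eq0 xi'_ss xi_f. Qed.
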